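(* Let $M, N$ be pure $\lambda$-terms. If $M =_{\beta\eta\mathrm{SP}} N$, then $M =_{\beta\eta} N$.
   Context: The $\lambda$-terms (with pairing and projections) are given by the grammar $M ::= x \mid \lambda x.M \mid M\,M \mid \langle M,M\rangle \mid \pi_1 M \mid \pi_2 M$, where $x$ ranges over an infinite set of variables; $\alpha$-equivalent terms are identified. $\mathrm{FV}(M)$ is the set of free variables of $M$, and $M[x:=N]$ is capture-avoiding substitution. A term is pure if it contains no occurrence of $\pi_1$, $\pi_2$ or $\langle\cdot,\cdot\rangle$. The relation $=_{\beta\eta\mathrm{SP}}$ is the reflexive-transitive-symmetric closure of the compatible closure (closure under all term constructors, i.e. under $\lambda x.[\,]$, both argument positions of application and of pairing, $\pi_1$ and $\pi_2$) on $\lambda$-terms of the following axioms: - $(\beta)$ $(\lambda x.M)\,N \rhd M[x:=N]$; - $(\eta)$ $\lambda x.M\,x \rhd M$ if $x\notin \mathrm{FV}(M)$; - $(\pi_1)$ $\pi_1\langle M,N\rangle \rhd M$; - $(\pi_2)$ $\pi_2\langle M,N\rangle \rhd N$; - $(\mathrm{SP})$ $\langle \pi_1 M,\pi_2 M\rangle \rhd M$. The relation $=_{\beta\eta}$ is the usual $\beta\eta$-equality on pure $\lambda$-terms, i.e. the equality of the untyped extensional lambda calculus (the congruence on pure terms generated by $(\beta)$ and $(\eta)$). *)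

(* Defs.v *)
From Stdlib Require Import Relations.

(* Lambda-terms with pairing, in de Bruijn notation, so that Leibniz equality
   is alpha-equivalence.  An index [n] lying under [k] binders denotes a bound
   variable if [n < k], and otherwise the free variable number [n - k]. *)
Inductive term : Type :=
  | Var (n : nat)
  | Lam (M : term)
  | App (M N : term)
  | Pair (M N : term)
  | Pi1 (M : term)
  | Pi2 (M : term).

Definition up_ren (xi : nat -> nat) (n : nat) : nat :=
  match n with
  | 0 => 0
  | S m => S (xi m)
  end.

Fixpoint rename (xi : nat -> nat) (M : term) : term :=
  match M with
  | Var n => Var (xi n)
  | Lam P => Lam (rename (up_ren xi) P)
  | App P Q => App (rename xi P) (rename xi Q)
  | Pair P Q => Pair (rename xi P) (rename xi Q)
  | Pi1 P => Pi1 (rename xi P)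
  | Pi2 P => Pi2 (rename xi P)
  end.

Definition shift (M : term) : term := rename S M.

Definition up (sigma : nat -> term) (n : nat) : term :=
  match n with
  | 0 => Var 0
  | S m => shift (sigma m)
  end.

(* Capture-avoiding simultaneous substitution. *)
Fixpoint subst (sigma : nat -> term) (M : term) : term :=
  match M with
  | Var n => sigma n
  | Lam P => Lam (subst (up sigma) P)
  | App P Q => App (subst sigma P) (subst sigma Q)
  | Pair P Q => Pair (subst sigma P) (subst sigma Q)
  | Pi1 P => Pi1 (subst sigma P)
  | Pi2 P => Pi2 (subst sigma P)
  end.

(* [subst0 N M] is M[x:=N] where [M] is the body of an abstraction over x:
   index 0 is replaced by [N] and the other indices are lowered by one. *)
Definition subst0 (N M : term) : term :=
  subst (fun n => match n with 0 => N | S m => Var m end) M.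

(* The side condition of [eta], that x is not free in M, is expressed by
   [shift]: the terms in which index 0 does not occur free are exactly those
   of the form [shift M]. *)
Inductive beta_eta : relation term :=
  | beta M N : beta_eta (App (Lam M) N) (subst0 N M)
  | eta M : beta_eta (Lam (App (shift M) (Var 0))) M.

Inductive beta_eta_SP : relation term :=
  | beta_eta_incl M N : beta_eta M N -> beta_eta_SP M N
  | proj1_pair M N : beta_eta_SP (Pi1 (Pair M N)) M
  | proj2_pair M N : beta_eta_SP (Pi2 (Pair M N)) N
  | surj_pair M : beta_eta_SP (Pair (Pi1 M) (Pi2 M)) M.

Inductive compatible_closure (R : relation term) : relation term :=
  | cc_base M N : R M N -> compatible_closure R M N
  | cc_Lam M M' :
      compatible_closure R M M' -> compatible_closure R (Lam M) (Lam M')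
  | cc_App_l M M' N :
      compatible_closure R M M' -> compatible_closure R (App M N) (App M' N)
  | cc_App_r M N N' :
      compatible_closure R N N' -> compatible_closure R (App M N) (App M N')
  | cc_Pair_l M M' N :
      compatible_closure R M M' -> compatible_closure R (Pair M N) (Pair M' N)
  | cc_Pair_r M N N' :
      compatible_closure R N N' -> compatible_closure R (Pair M N) (Pair M N')
  | cc_Pi1 M M' :
      compatible_closure R M M' -> compatible_closure R (Pi1 M) (Pi1 M')
  | cc_Pi2 M M' :
      compatible_closure R M M' -> compatible_closure R (Pi2 M) (Pi2 M').

Fixpoint pure (M : term) : Prop :=
  match M with
  | Var _ => True
  | Lam P => pure P
  | App P Q => pure P /\ pure Q
  | Pair _ _ => False
  | Pi1 _ => False
  | Pi2 _ => False
  end.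

Definition eq_beta_eta_SP : relation term :=
  clos_refl_sym_trans term (compatible_closure beta_eta_SP).

(* Every intermediate term of a conversion must be pure.  This has to be
   required explicitly, because a beta-expansion of a pure term can be impure.
   When both sides of a compatible step are pure, so are its context and its
   redex; the pairing and projection clauses of the closure play no role. *)
Definition pure_beta_eta_step : relation term :=
  fun M N => pure M /\ pure N /\ compatible_closure beta_eta M N.

Definition eq_beta_eta : relation term :=
  clos_refl_sym_trans term pure_beta_eta_step.

(* Main.v *)
Require Import Defs.
From Stdlib Require Import Relations FunctionalExtensionality IndefiniteDescription.

(** Surjective pairing says that a term is the same thing as its two
    projections, hence, unfolding for ever, the same thing as a family of
    components indexed by infinite binary paths.  In such a family pairing and
    projections merely shuffle indices, and application can be taken to act
    componentwise in its head while passing all components of the argument: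

      (M N)_s = M_s (N_s')_s'      (lambda x. M)_s = lambda (x_s')_s'. M_s.

    This translates lambda-terms with pairing into an infinitary lambda-calculus
    in which an abstraction binds a whole family of variables and an application
    takes a whole family of arguments ([component]).  The axioms for pairs become
    identities there, and beta and eta become the infinitary beta and eta, so
    each step of [beta_eta_SP] gives one parallel infinitary step on every
    component ([component_step]).

    The infinitary calculus is confluent: parallel beta-eta reduction has the
    diamond property ([par_diamond]), by induction on well-founded, infinitely
    branching terms.  So if two terms M and N are convertible with surjective
    pairing, their components at a path s have a common reduct t.

    It remains to come back.  In the component of a pure term the arguments
    passed to an application are the components of one single term.  The
    relation [represents t s M] says that t has this shape, up to beta-eta
    conversion of the pure terms involved, and that M is the pure term so read
    off at s.  The relation determines M up to conversion
    ([represents_unique]) and is stable under reduction of t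
    ([represents_par]), although reduction may rewrite the components of an
    argument in different ways.  Hence the common reduct t represents both M and
    N, which are therefore beta-eta convertible. *)

(** * Substitution and conversion for finite terms *)

Lemma up_ren_comp xi zeta :
  (fun n => up_ren xi (up_ren zeta n)) = up_ren (fun n => xi (zeta n)).
Proof. extensionality n; now destruct n. Qed.

Lemma rename_rename M : forall xi zeta,
  rename xi (rename zeta M) = rename (fun n => xi (zeta n)) M.
Proof.
  induction M; intros; simpl; f_equal; auto.
  now rewrite IHM, up_ren_comp.
Qed.

Lemma subst_rename M : forall sigma xi,
  subst sigma (rename xi M) = subst (fun n => sigma (xi n)) M.
Proof.
  induction M; intros; simpl; f_equal; auto.
  rewrite IHM; f_equal. extensionality n; now destruct n.
Qed.

Lemma rename_subst M : forall xi sigma,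
  rename xi (subst sigma M) = subst (fun n => rename xi (sigma n)) M.
Proof.
  induction M; intros; simpl; f_equal; auto.
  rewrite IHM; f_equal. extensionality n; destruct n; trivial; simpl.
  unfold shift. now rewrite !rename_rename.
Qed.

Lemma subst_subst M : forall sigma tau,
  subst sigma (subst tau M) = subst (fun n => subst sigma (tau n)) M.
Proof.
  induction M; intros; simpl; f_equal; auto.
  rewrite IHM; f_equal. extensionality n; destruct n; trivial; simpl.
  unfold shift. now rewrite subst_rename, rename_subst.
Qed.

Lemma rename_as_subst M : forall xi,
  rename xi M = subst (fun n => Var (xi n)) M.
Proof.
  induction M; intros; simpl; f_equal; auto.
  rewrite IHM; f_equal. extensionality n; now destruct n.
Qed.

Lemma subst_Var M : subst Var M = M.
Proof.
  induction M; simpl; f_equal; auto.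
  rewrite <- IHM at 2; f_equal. extensionality n; now destruct n.
Qed.

Lemma subst_shift sigma M : subst (up sigma) (shift M) = shift (subst sigma M).
Proof. unfold shift. now rewrite subst_rename, rename_subst. Qed.

Lemma subst_subst0 sigma M N :
  subst sigma (subst0 N M) = subst0 (subst sigma N) (subst (up sigma) M).
Proof.
  unfold subst0. rewrite !subst_subst; f_equal.
  extensionality n; destruct n; trivial; simpl.
  unfold shift. now rewrite subst_rename, subst_Var.
Qed.

Lemma pure_rename M : forall xi, pure M -> pure (rename xi M).
Proof. induction M; simpl; firstorder. Qed.

Lemma pure_subst M : forall sigma,
  pure M -> (forall n, pure (sigma n)) -> pure (subst sigma M).
Proof.
  induction M; simpl; intros; auto; try tauto.
  - apply IHM; trivial. intros [|n]; simpl; trivial. now apply pure_rename.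
  - firstorder.
Qed.

(** Conversion is reflexive on impure terms too, so it preserves purity without
    implying it. *)
Lemma conv_pure M N : eq_beta_eta M N -> (pure M <-> pure N).
Proof. induction 1 as [? ? [? [? ?]]| | |]; tauto. Qed.

Lemma conv_trans M N P : eq_beta_eta M N -> eq_beta_eta N P -> eq_beta_eta M P.
Proof. apply rst_trans. Qed.

Lemma conv_sym M N : eq_beta_eta M N -> eq_beta_eta N M.
Proof. apply rst_sym. Qed.

Lemma conv_refl M : eq_beta_eta M M.
Proof. apply rst_refl. Qed.

Lemma conv_context (C : term -> term) :
  (forall M N, pure_beta_eta_step M N -> pure_beta_eta_step (C M) (C N)) ->
  forall M N, eq_beta_eta M N -> eq_beta_eta (C M) (C N).
Proof.
  intros hC M N; induction 1.
  - apply rst_step; auto.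
  - apply conv_refl.
  - now apply conv_sym.
  - eapply conv_trans; eassumption.
Qed.

Lemma conv_Lam M N : eq_beta_eta M N -> eq_beta_eta (Lam M) (Lam N).
Proof.
  apply conv_context. intros ? ? [? [? ?]]; repeat split; trivial.
  now apply cc_Lam.
Qed.

(** A step inside [M] or [N] is a step between pure applications only if the
    other side of the application is pure. *)
Lemma conv_App M M' N N' :
  pure M -> pure N -> eq_beta_eta M M' -> eq_beta_eta N N' ->
  eq_beta_eta (App M N) (App M' N').
Proof.
  intros hM hN eM eN. apply conv_trans with (App M' N).
  - apply (conv_context (fun P => App P N)); trivial.
    intros ? ? [? [? ?]]; repeat split; trivial. now apply cc_App_l.
  - apply (conv_context (App M')); trivial. apply conv_pure in eM.
    intros ? ? [? [? ?]]; repeat split; try tauto. now apply cc_App_r.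
Qed.

Lemma beta_eta_step_subst M N : compatible_closure beta_eta M N ->
  forall sigma, compatible_closure beta_eta (subst sigma M) (subst sigma N).
Proof.
  induction 1 as [? ? [P Q|P]| | | | | | |]; intros; simpl;
    try (now constructor); apply cc_base.
  - rewrite subst_subst0. apply beta.
  - rewrite subst_shift. apply eta.
Qed.

Lemma conv_subst sigma M N : (forall n, pure (sigma n)) ->
  eq_beta_eta M N -> eq_beta_eta (subst sigma M) (subst sigma N).
Proof.
  intros hs. apply conv_context. intros ? ? [? [? ?]].
  repeat split; try now apply pure_subst.
  now apply beta_eta_step_subst.
Qed.

Lemma conv_rename xi M N :
  eq_beta_eta M N -> eq_beta_eta (rename xi M) (rename xi N).
Proof. intros e. rewrite !rename_as_subst. apply conv_subst; simpl; trivial. Qed.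

Lemma conv_beta M N : pure M -> pure N ->
  eq_beta_eta (App (Lam M) N) (subst0 N M).
Proof.
  intros. apply rst_step. repeat split; trivial.
  - apply pure_subst; trivial. now intros [|n].
  - apply cc_base, beta.
Qed.

Lemma conv_eta M : pure M -> eq_beta_eta (Lam (App (shift M) (Var 0))) M.
Proof.
  intros. apply rst_step. repeat split; trivial.
  - now apply pure_rename.
  - apply cc_base, eta.
Qed.

(** * The infinitary calculus *)

(** A path tells which projection to take at each level of the endless unfolding
    of a term into pairs; [false] stands for the first one. *)
Definition path := nat -> bool.

Definition pcons (b : bool) (s : path) : path :=
  fun n => match n with 0 => b | S m => s m end.

Definition ptail (s : path) : path := fun n => s (S n).

Lemma pcons_surj s : pcons (s 0) (ptail s) = s.
Proof. extensionality n; now destruct n. Qed.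

(** [IVar n s] is the component at [s] of the variable family number [n].  A
    binder binds all components of a family at once, so only [n] is a de Bruijn
    index. *)
Inductive iterm : Type :=
  | IVar (n : nat) (s : path)
  | ILam (t : iterm)
  | IApp (t : iterm) (f : path -> iterm).

Fixpoint irename (xi : nat -> nat) (t : iterm) : iterm :=
  match t with
  | IVar n s => IVar (xi n) s
  | ILam u => ILam (irename (up_ren xi) u)
  | IApp u f => IApp (irename xi u) (fun s => irename xi (f s))
  end.

Definition iup (sigma : nat -> path -> iterm) (n : nat) : path -> iterm :=
  match n with
  | 0 => IVar 0
  | S m => fun s => irename S (sigma m s)
  end.

Fixpoint isubst (sigma : nat -> path -> iterm) (t : iterm) : iterm :=
  match t with
  | IVar n s => sigma n s
  | ILam u => ILam (isubst (iup sigma) u)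
  | IApp u f => IApp (isubst sigma u) (fun s => isubst sigma (f s))
  end.

Definition inst (f : path -> iterm) (n : nat) : path -> iterm :=
  match n with
  | 0 => f
  | S m => IVar m
  end.

Lemma irename_irename t : forall xi zeta,
  irename xi (irename zeta t) = irename (fun n => xi (zeta n)) t.
Proof.
  induction t; intros; simpl; f_equal; auto.
  - now rewrite IHt, up_ren_comp.
  - extensionality s; auto.
Qed.

Lemma isubst_irename t : forall sigma xi,
  isubst sigma (irename xi t) = isubst (fun n => sigma (xi n)) t.
Proof.
  induction t; intros; simpl; f_equal; auto.
  - rewrite IHt; f_equal. extensionality n; now destruct n.
  - extensionality s; auto.
Qed.

Lemma irename_isubst t : forall xi sigma,
  irename xi (isubst sigma t) = isubst (fun n s => irename xi (sigma n s)) t.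
Proof.
  induction t; intros; simpl; f_equal; auto.
  - rewrite IHt; f_equal. extensionality n; extensionality s.
    destruct n; trivial; simpl. now rewrite !irename_irename.
  - extensionality s; auto.
Qed.

Lemma isubst_isubst t : forall sigma tau,
  isubst sigma (isubst tau t) = isubst (fun n s => isubst sigma (tau n s)) t.
Proof.
  induction t; intros; simpl; f_equal; auto.
  - rewrite IHt; f_equal. extensionality n; extensionality s.
    destruct n; trivial; simpl. now rewrite isubst_irename, irename_isubst.
  - extensionality s; auto.
Qed.

Lemma isubst_IVar t : isubst IVar t = t.
Proof.
  induction t; simpl; f_equal; auto.
  - rewrite <- IHt at 2; f_equal.
    extensionality n; extensionality s; now destruct n.
  - extensionality s; auto.
Qed.

Lemma irename_as_isubst t : forall xi,
  irename xi t = isubst (fun n => IVar (xi n)) t.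
Proof.
  induction t; intros; simpl; f_equal; auto.
  - rewrite IHt; f_equal. extensionality n; now destruct n.
  - extensionality s; auto.
Qed.

Lemma irename_pred_S t : irename pred (irename S t) = t.
Proof. rewrite irename_irename, irename_as_isubst. apply isubst_IVar. Qed.

Lemma isubst_inst_shift f t : isubst (inst f) (irename S t) = t.
Proof. rewrite isubst_irename. apply isubst_IVar. Qed.

Lemma irename_inst xi f t :
  irename xi (isubst (inst f) t)
  = isubst (inst (fun s => irename xi (f s))) (irename (up_ren xi) t).
Proof.
  rewrite irename_isubst, isubst_irename; f_equal.
  extensionality n; extensionality s; now destruct n.
Qed.

Lemma isubst_inst sigma f t :
  isubst sigma (isubst (inst f) t)
  = isubst (inst (fun s => isubst sigma (f s))) (isubst (iup sigma) t).
Proof.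
  rewrite !isubst_isubst; f_equal.
  extensionality n; extensionality s; destruct n; trivial; simpl.
  now rewrite isubst_inst_shift.
Qed.

(** All free variables satisfy [P].  This is what shows that a reduct of a
    shifted term is again a shifted term, which the side condition of eta
    requires in the proof of the diamond property. *)
Fixpoint vars_in (P : nat -> Prop) (t : iterm) : Prop :=
  match t with
  | IVar n _ => P n
  | ILam u => vars_in (fun n => match n with 0 => True | S m => P m end) u
  | IApp u f => vars_in P u /\ forall s, vars_in P (f s)
  end.

Lemma isubst_ext_on t : forall (P : nat -> Prop) sigma tau,
  vars_in P t -> (forall n, P n -> sigma n = tau n) ->
  isubst sigma t = isubst tau t.
Proof.
  induction t; simpl; intros P sigma tau ht e; f_equal.
  - now rewrite e.
  - eapply IHt; [exact ht|]. intros [|n] hn; simpl; trivial. now rewrite e.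
  - destruct ht; eauto.
  - destruct ht; extensionality s; eauto.
Qed.

Lemma vars_in_irename t : forall P xi,
  vars_in P (irename xi t) <-> vars_in (fun n => P (xi n)) t.
Proof.
  induction t; simpl; intros P xi.
  - reflexivity.
  - rewrite IHt. erewrite (f_equal (fun R => vars_in R t)); [reflexivity|].
    extensionality n; now destruct n.
  - rewrite IHt. split; intros []; split; trivial; intros s; now apply H.
Qed.

Lemma vars_in_isubst t : forall (P Q : nat -> Prop) sigma,
  vars_in P t -> (forall n, P n -> forall s, vars_in Q (sigma n s)) ->
  vars_in Q (isubst sigma t).
Proof.
  induction t; simpl; intros P Q sigma ht h; auto.
  - eapply IHt; [exact ht|]. intros [|n] hn s; simpl; trivial.
    now apply vars_in_irename, h.
  - destruct ht; split; eauto.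
Qed.

Lemma vars_in_True t : vars_in (fun _ => True) t.
Proof.
  induction t; simpl; auto.
  replace (fun n => match n with 0 => True | S _ => True end)
    with (fun _ : nat => True); trivial.
  extensionality n; now destruct n.
Qed.

Lemma vars_in_shift t : vars_in (fun n => n <> 0) (irename S t).
Proof.
  apply vars_in_irename. rewrite <- isubst_IVar.
  eapply vars_in_isubst; [apply vars_in_True|]. discriminate.
Qed.

Lemma shift_of_vars_in t :
  vars_in (fun n => n <> 0) t -> irename S (irename pred t) = t.
Proof.
  intros h. rewrite irename_irename, irename_as_isubst.
  rewrite <- (isubst_IVar t) at 2.
  eapply isubst_ext_on; [exact h|]. now intros [|n].
Qed.

(** * Confluence of the infinitary calculus *)

(** One step may contract redexes in all the infinitely many arguments of an
    application, which is what a single finite step inside an argument amounts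
    to after translation. *)
Inductive par : iterm -> iterm -> Prop :=
  | par_var n s : par (IVar n s) (IVar n s)
  | par_lam t t' : par t t' -> par (ILam t) (ILam t')
  | par_app t t' f f' :
      par t t' -> (forall s, par (f s) (f' s)) -> par (IApp t f) (IApp t' f')
  | par_beta t t' f f' :
      par t t' -> (forall s, par (f s) (f' s)) ->
      par (IApp (ILam t) f) (isubst (inst f') t')
  | par_eta t t' :
      par t t' -> par (ILam (IApp (irename S t) (IVar 0))) t'.

Lemma par_refl t : par t t.
Proof. induction t; constructor; auto. Qed.

Lemma par_irename t t' :
  par t t' -> forall xi, par (irename xi t) (irename xi t').
Proof.
  induction 1; intros; simpl.
  - constructor.
  - constructor; auto.
  - constructor; auto.
  - rewrite irename_inst. apply par_beta; auto.
  - replace (irename (up_ren xi) (irename S t)) with (irename S (irename xi t))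
      by now rewrite !irename_irename.
    apply par_eta; auto.
Qed.

Lemma par_isubst t t' : par t t' -> forall sigma sigma',
  (forall n s, par (sigma n s) (sigma' n s)) ->
  par (isubst sigma t) (isubst sigma' t').
Proof.
  assert (up_par : forall sigma sigma',
    (forall n s, par (sigma n s) (sigma' n s)) ->
    forall n s, par (iup sigma n s) (iup sigma' n s)).
  { intros ? ? h [|n] s; [apply par_refl|]. now apply par_irename. }
  induction 1; intros; simpl.
  - auto.
  - constructor; auto.
  - constructor; auto.
  - rewrite isubst_inst. apply par_beta; auto.
  - replace (isubst (iup sigma) (irename S t)) with (irename S (isubst sigma t))
      by now rewrite isubst_irename, irename_isubst.
    apply par_eta; auto.
Qed.

Lemma par_inst t t' f f' : par t t' -> (forall s, par (f s) (f' s)) ->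
  par (isubst (inst f) t) (isubst (inst f') t').
Proof.
  intros. apply par_isubst; trivial.
  intros [|n] s; simpl; trivial. constructor.
Qed.

Lemma par_vars_in t t' : par t t' -> forall P, vars_in P t -> vars_in P t'.
Proof.
  induction 1; simpl; intros P h; auto.
  - destruct h; split; auto.
  - destruct h as [h1 h2]. eapply vars_in_isubst; [apply IHpar, h1|].
    intros [|n] hn s; simpl; auto.
  - destruct h as [h _]. apply IHpar. now apply vars_in_irename in h.
Qed.

(** Reduction creates no free variables, and renaming by [pred] undoes the
    shift. *)
Lemma par_shift_inv t u : par (irename S t) u ->
  exists v, u = irename S v /\ par t v.
Proof.
  intros h. exists (irename pred u). split.
  - symmetry. apply shift_of_vars_in.
    eapply par_vars_in; [exact h|]. apply vars_in_shift.
  - rewrite <- (irename_pred_S t). now apply par_irename.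
Qed.

(** Structural induction with one more level of hypotheses.  In the diamond
    property the contractum of a redex is built from subterms two levels below
    it: the body of a contracted abstraction for beta, the head of the
    application for eta. *)
Lemma iterm_ind2 (P : iterm -> Prop) :
  (forall n s, P (IVar n s)) ->
  (forall t, P t -> (forall u f, t = IApp u f -> P u) -> P (ILam t)) ->
  (forall t f, P t -> (forall u, t = ILam u -> P u) -> (forall s, P (f s)) ->
     P (IApp t f)) ->
  forall t, P t.
Proof.
  intros hV hL hA t.
  enough (P t /\ match t with
                 | IVar _ _ => True
                 | ILam u => P u
                 | IApp u _ => P u
                 end) by tauto.
  induction t as [n s|t [IH IH']|t [IH IH'] f IHf].
  - auto.
  - split; trivial. apply hL; trivial. now intros u f ->.
  - split; trivial. apply hA; trivial.
    + now intros u ->.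
    + apply IHf.
Qed.

Definition joinable (t1 t2 : iterm) : Prop := exists t3, par t1 t3 /\ par t2 t3.

Definition diamond_at (t : iterm) : Prop :=
  forall t1 t2, par t t1 -> par t t2 -> joinable t1 t2.

Lemma joinable_sym t1 t2 : joinable t1 t2 -> joinable t2 t1.
Proof. intros (t3 & ? & ?). now exists t3. Qed.

(** Choice is needed to collect common reducts of infinitely many arguments into
    the argument family of one term. *)
Lemma joinable_family (f1 f2 : path -> iterm) :
  (forall s, joinable (f1 s) (f2 s)) ->
  exists f3, forall s, par (f1 s) (f3 s) /\ par (f2 s) (f3 s).
Proof. apply functional_choice. Qed.

Lemma diamond_unshift t : diamond_at (irename S t) -> diamond_at t.
Proof.
  intros D t1 t2 h1 h2.
  destruct (D (irename S t1) (irename S t2)) as (t3 & k1 & k2);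
    try now apply par_irename.
  exists (irename pred t3).
  rewrite <- (irename_pred_S t1), <- (irename_pred_S t2).
  split; now apply par_irename.
Qed.

(** The case where the abstraction of a beta-redex is itself an eta-redex needs
    no further analysis: then [r] reduces to [IApp (irename S u2) (IVar 0)],
    whose instance at [f2] is [IApp u2 f2], so that both sides are instances of
    reducts of [r]. *)
Lemma joinable_beta r r1 u2 f f1 f2 :
  diamond_at r -> (forall s, diamond_at (f s)) ->
  par r r1 -> par (ILam r) u2 ->
  (forall s, par (f s) (f1 s)) -> (forall s, par (f s) (f2 s)) ->
  joinable (isubst (inst f1) r1) (IApp u2 f2).
Proof.
  intros Dr Df hr hu h1 h2.
  destruct (joinable_family f1 f2) as (f3 & hf3).
  { intros s. now apply (Df s). }
  inversion hu; subst; clear hu.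
  - destruct (Dr r1 t') as (r3 & ? & ?); trivial.
    exists (isubst (inst f3) r3). split.
    + apply par_inst; firstorder.
    + apply par_beta; firstorder.
  - destruct (Dr r1 (IApp (irename S u2) (IVar 0))) as (r3 & ? & k2); trivial.
    { apply par_app; [now apply par_irename|]. intros; apply par_refl. }
    exists (isubst (inst f3) r3). split.
    + apply par_inst; firstorder.
    + rewrite <- (isubst_inst_shift f2 u2).
      change (par (isubst (inst f2) (IApp (irename S u2) (IVar 0)))
                  (isubst (inst f3) r3)).
      apply par_inst; firstorder.
Qed.

(** If the body of an eta-redex reduces by beta at its root, then [v] is an
    abstraction, and contracting the outer eta-redex or the inner beta-redex
    gives reducts of [v] itself. *)
Lemma joinable_eta v v2 r1 : diamond_at v -> par v v2 ->
  par (IApp (irename S v) (IVar 0)) r1 -> joinable (ILam r1) v2.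
Proof.
  intros D hv h. inversion h as [| |? w ? g hw hg|q q1 ? g hq hg e|]; subst; clear h.
  - apply par_shift_inv in hw as (v1 & -> & hv1).
    replace g with (IVar 0).
    2: { extensionality s. specialize (hg s). now inversion hg. }
    destruct (D v1 v2) as (v3 & ? & ?); trivial.
    exists v3. split; trivial. now apply par_eta.
  - destruct (par_shift_inv v (ILam q1)) as (v1 & e1 & hv1).
    { rewrite <- e. now apply par_lam. }
    replace g with (IVar 0).
    2: { extensionality s. specialize (hg s). now inversion hg. }
    (* The body [q1] is shifted under the binder, so substituting variable 0 for
       the bound variable only undoes the shift. *)
    destruct v1 as [|q1'|]; try discriminate. injection e1 as ->.
    replace (isubst (inst (IVar 0)) (irename (up_ren S) q1')) with q1'.
    + now apply D.
    + rewrite isubst_irename. rewrite <- (isubst_IVar q1') at 1; f_equal.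
      extensionality n; now destruct n.
Qed.

Lemma par_diamond t : diamond_at t.
Proof.
  induction t as [n s|r Dr Dr'|u f Du Du' Df] using iterm_ind2;
    intros t1 t2 h1 h2.
  - inversion h1; inversion h2; subst. exists (IVar n s); split; constructor.
  - inversion h1 as [|? r1 k1| | |v ? k1]; subst; clear h1;
    inversion h2 as [|? r2 k2| | |v' ? k2 e]; subst; clear h2.
    + destruct (Dr r1 r2) as (r3 & ? & ?); trivial.
      exists (ILam r3). split; now constructor.
    + eapply joinable_eta;
        [eapply diamond_unshift, Dr'; reflexivity|eassumption..].
    + apply joinable_sym. eapply joinable_eta;
        [eapply diamond_unshift, Dr'; reflexivity|eassumption..].
    + assert (v' = v) as -> by
        (rewrite <- (irename_pred_S v), <- e; symmetry; apply irename_pred_S).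
      revert k1 k2. apply diamond_unshift. eapply Dr'; reflexivity.
  - inversion h1 as [| |? u1 ? f1 k1 m1|r r1 ? f1 k1 m1|]; subst; clear h1;
    inversion h2 as [| |? u2 ? f2 k2 m2|r' r2 ? f2 k2 m2|]; subst; clear h2.
    + destruct (Du u1 u2) as (u3 & ? & ?); trivial.
      destruct (joinable_family f1 f2) as (f3 & ?).
      { intros s. now apply (Df s). }
      exists (IApp u3 f3). split; constructor; firstorder.
    + apply joinable_sym. eapply joinable_beta; [now apply Du'|eassumption..].
    + eapply joinable_beta; [now apply Du'|eassumption..].
    + destruct (Du' r eq_refl r1 r2) as (r3 & ? & ?); trivial.
      destruct (joinable_family f1 f2) as (f3 & ?).
      { intros s. now apply (Df s). }
      exists (isubst (inst f3) r3). split; apply par_inst; firstorder.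
Qed.

Definition pars := clos_refl_trans_1n iterm par.

Lemma par_pars_strip t t1 t2 : pars t t2 -> par t t1 ->
  exists t3, pars t1 t3 /\ par t2 t3.
Proof.
  intros h; revert t1. induction h as [t|t u t2 hu _ IH]; intros t1 h1.
  - exists t1. split; [constructor|trivial].
  - destruct (par_diamond t t1 u h1 hu) as (w & k1 & k2).
    destruct (IH w k2) as (t3 & ? & ?). exists t3; split; trivial.
    now apply Relation_Operators.rt1n_trans with w.
Qed.

Lemma pars_confluent t t1 t2 : pars t t1 -> pars t t2 ->
  exists t3, pars t1 t3 /\ pars t2 t3.
Proof.
  intros h; revert t2. induction h as [t|t u t1 hu _ IH]; intros t2 h2.
  - exists t2. split; [trivial|constructor].
  - destruct (par_pars_strip t u t2 h2 hu) as (w & k1 & k2).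
    destruct (IH w k1) as (t3 & ? & ?). exists t3; split; trivial.
    now apply Relation_Operators.rt1n_trans with w.
Qed.

Lemma pars_trans t u v : pars t u -> pars u v -> pars t v.
Proof.
  intros h k; induction h as [|t w u hw _ IH]; trivial.
  apply Relation_Operators.rt1n_trans with w; [exact hw|now apply IH].
Qed.

(** * Components of terms with pairing *)

Fixpoint component (s : path) (M : term) : iterm :=
  match M with
  | Var n => IVar n s
  | Lam P => ILam (component s P)
  | App P Q => IApp (component s P) (fun s' => component s' Q)
  | Pair P Q => if s 0 then component (ptail s) Q else component (ptail s) P
  | Pi1 P => component (pcons false s) P
  | Pi2 P => component (pcons true s) P
  end.

Lemma component_rename M : forall xi s,
  component s (rename xi M) = irename xi (component s M).
Proof.
  induction M; intros; simpl; f_equal; auto.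
  - extensionality s'; auto.
  - destruct (s 0); auto.
Qed.

Lemma component_subst M : forall sigma s,
  component s (subst sigma M)
  = isubst (fun n s' => component s' (sigma n)) (component s M).
Proof.
  induction M; intros; simpl; f_equal; auto.
  - rewrite IHM; f_equal. extensionality n; extensionality s'.
    destruct n; trivial; simpl. apply component_rename.
  - extensionality s'; auto.
  - destruct (s 0); auto.
Qed.

Lemma component_subst0 M N s :
  component s (subst0 N M)
  = isubst (inst (fun s' => component s' N)) (component s M).
Proof.
  unfold subst0. rewrite component_subst; f_equal.
  extensionality n; extensionality s'; now destruct n.
Qed.

(** The components of the two sides of a pairing axiom are equal, so such a step
    becomes the reflexive parallel step. *)
Lemma component_step M N : compatible_closure beta_eta_SP M N ->
  forall s, par (component s M) (component s N).
Proof.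
  induction 1 as [? ? [? ? [M N|M]|M N|M N|M]| | | | | | |]; intros s; simpl.
  - rewrite component_subst0. apply par_beta; intros; apply par_refl.
  - unfold shift. rewrite component_rename. apply par_eta, par_refl.
  - apply par_refl.
  - apply par_refl.
  - pose proof (pcons_surj s) as e.
    destruct (s 0); rewrite e; apply par_refl.
  - now constructor.
  - constructor; trivial. intros; apply par_refl.
  - constructor; trivial. apply par_refl.
  - destruct (s 0); trivial. apply par_refl.
  - destruct (s 0); trivial. apply par_refl.
  - trivial.
  - trivial.
Qed.

Lemma component_eq M N s : eq_beta_eta_SP M N ->
  exists t, pars (component s M) t /\ pars (component s N) t.
Proof.
  induction 1 as [M N h|M|M N _ (t & ? & ?)|M N P _ (t & a & b) _ (u & c & d)].
  - exists (component s N). split; [|constructor].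
    eapply Relation_Operators.rt1n_trans; [|constructor].
    now apply component_step.
  - exists (component s M). split; constructor.
  - now exists t.
  - destruct (pars_confluent _ t u b c) as (v & ? & ?).
    exists v. split; eapply pars_trans; eassumption.
Qed.

(** * Reading pure terms back *)

(** Conversion is built into each clause, so that reducing [t] need not change
    the represented term, and the argument clause asks all components for the
    same [Q], so that different reducts of the components of an argument still
    count as components of one term. *)
Fixpoint represents (t : iterm) (s : path) (M : term) : Prop :=
  match t with
  | IVar n s' => s' = s /\ pure M /\ eq_beta_eta M (Var n)
  | ILam u => exists P, represents u s P /\ eq_beta_eta M (Lam P)
  | IApp u f => exists P Q,
      represents u s P /\ (forall s', represents (f s') s' Q) /\
      eq_beta_eta M (App P Q)
  end.

Lemma represents_pure t : forall s M, represents t s M -> pure M.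
Proof.
  induction t; simpl.
  - tauto.
  - intros s M (P & hP & e). apply conv_pure in e. apply e. simpl; eauto.
  - intros s M (P & Q & hP & hQ & e). apply conv_pure in e. apply e.
    simpl; split; [eauto|exact (H s s Q (hQ s))].
Qed.

Lemma represents_conv t s M N :
  represents t s M -> eq_beta_eta M N -> represents t s N.
Proof.
  intros h e. pose proof (proj1 (conv_pure _ _ e)) as p. apply conv_sym in e.
  destruct t; simpl in *.
  - destruct h as (-> & ? & ?); repeat split; auto. eapply conv_trans; eassumption.
  - destruct h as (P & ? & ?). exists P; split; trivial.
    eapply conv_trans; eassumption.
  - destruct h as (P & Q & ? & ? & ?). exists P, Q; repeat split; trivial.
    eapply conv_trans; eassumption.
Qed.

(** In the application case any single component of the argument suffices to
    recover it. *)
Lemma represents_unique t : forall s M N,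
  represents t s M -> represents t s N -> eq_beta_eta M N.
Proof.
  induction t as [n s0|t IH|t IH f IHf]; simpl; intros s M N hM hN.
  - destruct hM as (_ & _ & ?), hN as (_ & _ & ?).
    eapply conv_trans; [eassumption|]. now apply conv_sym.
  - destruct hM as (P & ? & ?), hN as (P' & ? & ?).
    eapply conv_trans; [eassumption|].
    eapply conv_trans; [|apply conv_sym; eassumption].
    apply conv_Lam; eauto.
  - destruct hM as (P & Q & ? & hQ & ?), hN as (P' & Q' & ? & hQ' & ?).
    eapply conv_trans; [eassumption|].
    eapply conv_trans; [|apply conv_sym; eassumption].
    apply conv_App.
    + eauto using represents_pure.
    + exact (represents_pure _ _ _ (hQ s)).
    + eauto.
    + now apply (IHf s s).
Qed.

Lemma represents_component M : pure M -> forall s, represents (component s M) s M.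
Proof.
  induction M; simpl; try tauto; intros h s.
  - repeat split. apply conv_refl.
  - exists M. split; auto. apply conv_refl.
  - destruct h. exists M1, M2. repeat split; auto. apply conv_refl.
Qed.

Lemma represents_rename t : forall xi s M,
  represents t s M -> represents (irename xi t) s (rename xi M).
Proof.
  induction t as [n s0|t IH|t IH f IHf]; simpl; intros xi s M h.
  - destruct h as (-> & ? & e). repeat split; [now apply pure_rename|].
    now apply (conv_rename xi) in e.
  - destruct h as (P & ? & e). exists (rename (up_ren xi) P); split; auto.
    now apply (conv_rename xi) in e.
  - destruct h as (P & Q & ? & ? & e).
    exists (rename xi P), (rename xi Q); repeat split; auto.
    now apply (conv_rename xi) in e.
Qed.

Lemma represents_subst t : forall sigma tau s M,
  (forall n s', represents (sigma n s') s' (tau n)) ->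
  represents t s M -> represents (isubst sigma t) s (subst tau M).
Proof.
  induction t as [n s0|t IH|t IH f IHf]; simpl; intros sigma tau s M hs h;
    assert (ht : forall n, pure (tau n))
      by (intros m; exact (represents_pure _ _ _ (hs m s))).
  - destruct h as (-> & ? & e). apply represents_conv with (tau n); auto.
    apply conv_sym. now apply (conv_subst tau) in e.
  - destruct h as (P & ? & e). exists (subst (up tau) P); split.
    + apply IH; trivial. intros [|n] s'; simpl.
      * repeat split. apply conv_refl.
      * now apply represents_rename.
    + now apply (conv_subst tau) in e.
  - destruct h as (P & Q & ? & ? & e).
    exists (subst tau P), (subst tau Q); repeat split; auto.
    now apply (conv_subst tau) in e.
Qed.

(** The side condition of eta transfers to the represented term up to
    conversion: [M] and its lowered and shifted copy are represented by the same
    [irename S t], hence convertible. *)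
Lemma represents_unshift t s M : represents (irename S t) s M ->
  represents t s (rename pred M) /\ eq_beta_eta M (shift (rename pred M)).
Proof.
  intros h.
  assert (k : represents t s (rename pred M)).
  { rewrite <- (irename_pred_S t). now apply represents_rename. }
  split; trivial. apply (represents_unique _ _ _ _ h). now apply represents_rename.
Qed.

Lemma represents_par t t' : par t t' ->
  forall s M, represents t s M -> represents t' s M.
Proof.
  induction 1 as [n s0|t t' _ IH|t t' f f' _ IH _ IHf|t t' f f' _ IH _ IHf|t t' _ IH];
    intros s M h; simpl in h.
  - exact h.
  - destruct h as (P & ? & ?). exists P; auto.
  - destruct h as (P & Q & ? & ? & ?). exists P, Q; auto.
  - destruct h as (P & Q & (R & hR & eP) & hQ & eM).
    apply represents_conv with (subst0 Q R).
    + apply represents_subst; auto. intros [|n] s'; simpl; auto.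
      repeat split. apply conv_refl.
    + pose proof (represents_pure _ _ _ hR).
      pose proof (represents_pure _ _ _ (hQ s)).
      apply conv_sym. eapply conv_trans; [exact eM|].
      eapply conv_trans; [|now apply conv_beta].
      apply conv_App; trivial; [|apply conv_refl].
      now apply (conv_pure _ _ eP).
  - destruct h as (L & (P & Q & hP & hQ & eL) & eM).
    apply represents_unshift in hP as [hP eP].
    apply IH, represents_conv with (rename pred P); trivial.
    pose proof (represents_pure _ _ _ hP).
    apply conv_sym. eapply conv_trans; [exact eM|].
    eapply conv_trans; [|now apply conv_eta].
    apply conv_Lam. eapply conv_trans; [exact eL|].
    destruct (hQ s) as (_ & ? & ?).
    apply conv_App; trivial.
    apply (conv_pure _ _ eP). now apply pure_rename.
Qed.

Lemma represents_pars t t' : pars t t' ->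
  forall s M, represents t s M -> represents t' s M.
Proof. induction 1; eauto using represents_par. Qed.

Theorem theorem5p7 (M N : term) (hM : pure M) (hN : pure N) :
  eq_beta_eta_SP M N -> eq_beta_eta M N.
Proof.
  intros h.
  (* One path is enough, and any path will do. *)
  set (s := fun _ : nat => false).
  destruct (component_eq M N s h) as (t & hMt & hNt).
  apply (represents_unique t s).
  - apply (represents_pars _ _ hMt). now apply represents_component.
  - apply (represents_pars _ _ hNt). now apply represents_component.
Qed.
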